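(* For a positive integer $n$, let $A(n)$ denote the number of partitions of $n$ into parts $\equiv \pm 1,\pm 2 \pmod 7$. Let $B(n)$ denote the number of bipartitions $(\pi,\lambda)$ of $n$, where $\pi$ is a partition into distinct even parts with a gap of at least $4$ between consecutive parts, and $\lambda$ is a partition into distinct parts such that if $e_j$ is the $j$-th part in $\pi$ (where the parts are ordered in ascending order), then the parts $e_j/2$, $e_j/2+1$ and $e_j/2+2$ are not present in $\lambda$. Let $C(n)$ denote the number of bipartitions $(\pi,\mu)$ of $n$, where $\pi$ is a partition into distinct even parts with a gap of at least $4$ between consecutive parts, and $\mu$ is a partition into distinct parts such that if $e_j$ is the $j$-th part in $\pi$ (where the parts are ordered in ascending order), then the parts $e_j/2+j-1$, $e_j/2+j$ and $e_j/2+j+1$ are not present in $\mu$. Then $A(n)=B(n)=C(n)$ for every positive integer $n$.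
   Context: The union $\pi\cup\lambda$ of partitions $\pi$ and $\lambda$ is the partition whose parts are those of $\pi$ and $\lambda$ together (with multiplicity), arranged in non-increasing order. A bipartition of a positive integer $n$ is an ordered pair of partitions $(\pi,\lambda)$ such that $\pi\cup\lambda$ is a partition of $n$; $\pi$ or $\lambda$ may be empty. The exclusion conditions are imposed for every part $e_j$ of $\pi$, where $e_1<e_2<\cdots$ are the parts of $\pi$. *)

(* Defs.v *)
From HB Require Import structures.
From mathcomp Require Import all_boot.

Set Implicit Arguments.
Unset Strict Implicit.
Unset Printing Implicit Defensive.

(* The empty sequence is the (empty) partition of 0. *)
Definition is_partition (p : seq nat) : bool :=
  sorted geq p && (0 \notin p).

Definition is_partition_of (n : nat) (p : seq nat) : bool :=
  is_partition p && (sumn p == n).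

Definition part_union (p l : seq nat) : seq nat := sort geq (p ++ l).

Definition is_bipartition_of (n : nat) (b : seq nat * seq nat) : bool :=
  [&& is_partition b.1, is_partition b.2 &
      is_partition_of n (part_union b.1 b.2)].

Record partition_of (n : nat) : Type := PartitionOf {
  parts :> seq nat;
  partsP : is_partition_of n parts
}.

Record bipartition_of (n : nat) : Type := BipartitionOf {
  bparts :> seq nat * seq nat;
  bpartsP : is_bipartition_of n bparts
}.

Set Warnings "-redundant-canonical-projection".
HB.instance Definition _ n := [isSub for @parts n].
HB.instance Definition _ n := [Countable of partition_of n by <:].
HB.instance Definition _ n := [isSub for @bparts n].
HB.instance Definition _ n := [Countable of bipartition_of n by <:].

(* Finiteness: a partition of m <= n has at most n parts, all at most n. *)
Definition bounded_seqs (n : nat) : seq (seq nat) :=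
  [seq map (@nat_of_ord n.+1) w | w : {bseq n of 'I_n.+1}].

Lemma bounded_seqs_uniq n : uniq (bounded_seqs n).
Proof.
rewrite map_inj_uniq ?enum_uniq // => u v e.
exact/val_inj/(inj_map val_inj).
Qed.

Lemma mem_bounded_seqs n p :
  is_partition p -> sumn p <= n -> p \in bounded_seqs n.
Proof.
move=> /andP[_ p0] sp.
have szp : size p <= n.
  apply: leq_trans sp; elim: p p0 => //= x p IH.
  rewrite inE negb_or eq_sym -lt0n => /andP[x0 /IH sp].
  by rewrite -add1n leq_add.
have lep x : x \in p -> x < n.+1.
  move=> xp; rewrite ltnS; apply: leq_trans sp; elim: p xp {p0 szp} => //= y p IH.
  rewrite inE => /orP[/eqP->|/IH]; first exact: leq_addr.
  by move=> /leq_trans; apply; exact: leq_addl.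
have szw : size (map (@inord n) p) <= n by rewrite size_map.
apply/imageP; exists (Bseq szw) => //=.
rewrite -map_comp -[LHS]map_id; apply/eq_in_map => x xp /=.
by rewrite inordK ?lep.
Qed.

Definition partition_enum n : seq (partition_of n) :=
  pmap insub (bounded_seqs n).

Lemma partition_enumP n : Finite.axiom (partition_enum n).
Proof.
apply: Finite.uniq_enumP; first exact/pmap_sub_uniq/bounded_seqs_uniq.
move=> p; rewrite mem_pmap_sub !inE; case: p => p /= /andP[pp /eqP sp].
by rewrite mem_bounded_seqs ?sp.
Qed.

HB.instance Definition _ n :=
  isFinite.Build (partition_of n) (@partition_enumP n).

Lemma sumn_part_union p l : sumn (part_union p l) = sumn p + sumn l.
Proof. by rewrite -sumn_cat; apply: perm_sumn; rewrite perm_sort. Qed.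

Definition bipartition_enum n : seq (bipartition_of n) :=
  pmap insub [seq (p, l) | p <- bounded_seqs n, l <- bounded_seqs n].

Lemma bipartition_enumP n : Finite.axiom (bipartition_enum n).
Proof.
apply: Finite.uniq_enumP.
  apply: pmap_sub_uniq; apply: allpairs_uniq; try exact: bounded_seqs_uniq.
  by move=> [? ?] [? ?].
move=> b; rewrite mem_pmap_sub !inE; case: b => [[p l]] /= /and3P[/= hp hl].
rewrite /is_partition_of sumn_part_union => /andP[_ /eqP <-].
by rewrite allpairs_f ?mem_bounded_seqs ?leq_addr ?leq_addl.
Qed.

HB.instance Definition _ n :=
  isFinite.Build (bipartition_of n) (@bipartition_enumP n).

Definition parts_pm12_mod7 (p : seq nat) : bool :=
  all (fun i => [|| i == 1 %[mod 7], i == 2 %[mod 7],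
                    i == 5 %[mod 7] | i == 6 %[mod 7]]) p.

Definition distinct_even_gap4 (p : seq nat) : bool :=
  [&& uniq p, all (fun e => ~~ odd e) p & sorted (fun x y => y + 4 <= x) p].

(* The j-th part in ascending order, j = 1, ..., size p; partitions are stored
   in non-increasing order. *)
Definition asc_part (p : seq nat) (j : nat) : nat := nth 0 (rev p) j.-1.

Definition B_cond (p l : seq nat) : bool :=
  [&& distinct_even_gap4 p, uniq l &
      all (fun j => let e := asc_part p j in
             [&& e %/ 2 \notin l, e %/ 2 + 1 \notin l & e %/ 2 + 2 \notin l])
          (iota 1 (size p))].

Definition C_cond (p m : seq nat) : bool :=
  [&& distinct_even_gap4 p, uniq m &
      all (fun j => let e := asc_part p j in
             [&& e %/ 2 + j - 1 \notin m, e %/ 2 + j \notin m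
               & e %/ 2 + j + 1 \notin m])
          (iota 1 (size p))].

Definition A (n : nat) : nat :=
  #|[set p : partition_of n | parts_pm12_mod7 p]|.

Definition B (n : nat) : nat :=
  #|[set b : bipartition_of n | B_cond b.1 b.2]|.

Definition C (n : nat) : nat :=
  #|[set b : bipartition_of n | C_cond b.1 b.2]|.

(* Main.v *)
Require Import Defs.
From mathcomp Require Import all_boot.
From mathcomp Require Import ssralg poly polydiv ssrnum ssrint qpoly zify ring.

(** Everything happens over a commutative ring with a nilpotent [q], where
    infinite sums and products in [q] are finite; the coefficients are read off
    in Z[X]/(X^N).

    Halving the parts of pi turns a bipartition into a row of tiles, each of
    which blocks three positions for lambda. With n tiles, all at positions
    >= m, splitting on whether m carries a tile gives a recursion in m, solved
    for both B and C by the Rogers-Selberg summand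
      q^(2n(n-1) + 2nm) (1 + q^(m+2n)) (1 + q^(m+2n+1)) ... / (q^2; q^2)_n.
    Hence B = C. Summed over n, the B-recursion reads
      U_m = (1 + q^m) U_(m+1) + q^(2m) (U_(m+2) - q^(m+2) U_(m+3)),
    which, up to the factor (q^m; q)_oo, is the recursion of Gordon's function
    J_(3,3)(q^(m-1)). At m = 1 the latter is a theta series, and the Jacobi
    triple product in base q^7 turns it into the generating function of A. *)

Set Implicit Arguments.
Unset Strict Implicit.
Unset Printing Implicit Defensive.
Import GRing.Theory.
Import Pdiv.CommonRing Pdiv.RingMonic.
Local Open Scope ring_scope.

(** * Gaussian binomials and the finite triple product *)

Section GaussianBinomials.
Variables (R : comNzRingType) (Q : R).

Fixpoint gauss (m k : nat) : R :=
  match m, k with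
  | _, 0 => 1
  | 0, _.+1 => 0
  | m'.+1, k'.+1 => gauss m' k' + Q ^+ k * gauss m' k
  end.

Lemma gauss0 m : gauss m 0 = 1.
Proof. by case: m. Qed.

Lemma gaussS m k : gauss m.+1 k.+1 = gauss m k + Q ^+ k.+1 * gauss m k.+1.
Proof. by []. Qed.

Lemma gauss_small m k : (m < k)%N -> gauss m k = 0.
Proof.
elim: m k => [|m IH] [|k] //= mk.
by rewrite !IH ?mulr0 ?addr0 //; lia.
Qed.

(** In the inductive step the left side is expanded by this rule at [m] and the right side by
    [gaussS]. Comparing the two Pascal rules gives the absorption identities below. *)
Lemma gaussS_dual m k :
  gauss m.+1 k.+1 = Q ^+ (m - k) * gauss m k + gauss m k.+1.
Proof.
elim: m k => [|m IH] [|k]; rewrite gaussS.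
- by rewrite /= !mulr0 !addr0 mulr1.
- by rewrite /= !mulr0 !addr0.
- rewrite {1}(IH 0) (gaussS m 0) !gauss0 !subn0 [in RHS]exprS expr1; ring.
rewrite {1}(IH k) {1}(IH k.+1) (gaussS m k) (gaussS m k.+1).
rewrite !subSS; have [km|mk] := ltnP k m.
  have -> : Q ^+ (m - k) = Q * Q ^+ (m - k.+1) by rewrite -exprS; congr (_ ^+ _); lia.
  by rewrite [Q ^+ k.+2]exprS; ring.
(* The truncated exponent [m - k.+1] is harmless here, because its factor [gauss m k.+1] is zero. *)
by rewrite (@gauss_small m k.+1) ?(@gauss_small m k.+2) ?subSS; [ring|lia|lia].
Qed.

(** One copy of the left binomial is expanded by [gaussS], the other by [gaussS_dual]; the terms in
    [gauss m k.+1] then cancel. *)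
Lemma gauss_absorb m k :
  (k <= m)%N -> (1 - Q ^+ k.+1) * gauss m.+1 k.+1 = (1 - Q ^+ m.+1) * gauss m k.
Proof.
move=> km; have h := gaussS_dual m k.
rewrite mulrBl mul1r {1}gaussS h mulrDr mulrA -exprD.
have -> : (k.+1 + (m - k))%N = m.+1 by lia.
by ring.
Qed.

Lemma gauss_shift m k :
  (1 - Q ^+ k.+1) * gauss m k.+1 = (1 - Q ^+ (m - k)) * gauss m k.
Proof.
have := gaussS_dual m k; rewrite gaussS => h.
transitivity (gauss m k + gauss m k.+1 - (gauss m k + Q ^+ k.+1 * gauss m k.+1)).
  by ring.
by rewrite h; ring.
Qed.

Lemma gauss_absorb_compl m k :
  (k <= m)%N -> (1 - Q ^+ (m.+1 - k)) * gauss m.+1 k = (1 - Q ^+ m.+1) * gauss m k.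
Proof.
case: k => [|k] km; first by rewrite !gauss0 subn0.
rewrite subSS gaussS mulrDr -gauss_shift.
have -> : Q ^+ m.+1 = Q ^+ (m - k) * Q ^+ k.+1 by rewrite -exprD; congr (_ ^+ _); lia.
by ring.
Qed.

Definition qpoch n : R := \prod_(i < n) (1 - Q ^+ i.+1).

Lemma qpochS n : qpoch n.+1 = qpoch n * (1 - Q ^+ n.+1).
Proof. exact: big_ord_recr. Qed.

Lemma gauss_qpoch m k :
  (k <= m)%N -> qpoch k * qpoch (m - k) * gauss m k = qpoch m.
Proof.
elim: k m => [|k IH] m km.
  by rewrite gauss0 subn0 /qpoch big_ord0; ring.
case: m km => // m km; rewrite subSS !qpochS.
transitivity (qpoch k * qpoch (m - k) * ((1 - Q ^+ k.+1) * gauss m.+1 k.+1)).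
  by ring.
by rewrite gauss_absorb // mulrCA IH // mulrC.
Qed.
End GaussianBinomials.

Section FiniteTripleProduct.
Variables (R : comNzRingType) (a b : R).
Local Notation Q := (a * b).

(* The weight [a^(j(j+1)/2) b^(j(j-1)/2)] of the integer [j = k - n]; truncated
   subtraction kills one summand of each exponent. *)
Definition theta_wt (n k : nat) : R :=
  a ^+ ('C((k - n).+1, 2) + 'C(n - k, 2)) *
  b ^+ ('C(k - n, 2) + 'C((n - k).+1, 2)).

Lemma theta_wtSl n k : theta_wt n.+1 k.+1 = theta_wt n k.
Proof. by rewrite /theta_wt !subSS. Qed.

Lemma binS2 n : 'C(n.+1, 2) = ('C(n, 2) + n)%N.
Proof. by rewrite binS bin1. Qed.

(** Consecutive weights have ratio [a Q^(k-n)]. This lemma and the next clear the possibly negative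
    power of [Q] in the two ways that the two Pascal rules require. *)
Lemma theta_wt_step_a m n k : (k <= m + n)%N ->
  a * Q ^+ m * theta_wt n k = Q ^+ (m + n - k) * theta_wt n k.+1.
Proof.
move=> kmn; rewrite /theta_wt !exprMn.
have [nk|kn] := leqP n k.
  have [-> ->] : (n - k = 0 /\ n - k.+1 = 0)%N by lia.
  rewrite (subSn nk) !binS2; set e := (k - n)%N.
  rewrite (_ : m = m + n - k + e)%N; last by rewrite /e; lia.
  rewrite (_ : m + n - k + e + n - k = m + n - k)%N; last by rewrite /e; lia.
  by rewrite !(exprD, exprS); ring.
have [-> ->] : (k - n = 0 /\ k.+1 - n = 0)%N by lia.
rewrite (subnSK kn) (_ : m + n - k = m + (n - k.+1).+1)%N; last by lia.
rewrite (_ : n - k = (n - k.+1).+1)%N; last by lia.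
by rewrite !binS2 !(exprD, exprS); ring.
Qed.

Lemma theta_wt_step_b n k :
  Q ^+ k.+1 * theta_wt n k = b * Q ^+ n * theta_wt n k.+1.
Proof.
rewrite /theta_wt !exprMn.
have [nk|kn] := leqP n k.
  have [-> ->] : (n - k = 0 /\ n - k.+1 = 0)%N by lia.
  rewrite (subSn nk) !binS2; set e := (k - n)%N.
  rewrite (_ : k = e + n)%N; last by rewrite /e; lia.
  by rewrite !(exprD, exprS); ring.
have [-> ->] : (k - n = 0 /\ k.+1 - n = 0)%N by lia.
rewrite (subnSK kn).
have nE := subnKC kn; move: (n - k.+1)%N nE => d <-.
rewrite (_ : k.+1 + d - k = d.+1)%N; last by lia.
by rewrite !binS2 !(exprD, exprS); ring.
Qed.

Definition theta_sum m n : R :=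
  \sum_(k < (m + n).+1) (-1) ^+ k * theta_wt n k * gauss Q (m + n) k.

Lemma theta_sum_widen m n :
  theta_sum m n =
  \sum_(k < (m + n).+2) (-1) ^+ k * theta_wt n k * gauss Q (m + n) k.
Proof. by rewrite [RHS]big_ord_recr /= gauss_small ?mulr0 ?addr0. Qed.

Lemma theta_sumSl m n : theta_sum m.+1 n = (1 - a * Q ^+ m) * theta_sum m n.
Proof.
rewrite mulrBl mul1r {1}/theta_sum addSn {1}(theta_sum_widen m n).
rewrite big_ord_recl [in RHS]big_ord_recl !gauss0 -addrA; congr (_ + _).
rewrite /theta_sum mulr_sumr -sumrB.
apply: eq_bigr => k _; rewrite lift0 gaussS_dual.
have wE : a * Q ^+ m * theta_wt n k = Q ^+ (m + n - k) * theta_wt n k.+1.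
  by apply: theta_wt_step_a; rewrite -ltnS.
rewrite mulrA (mulrCA (a * Q ^+ m)) wE exprS; ring.
Qed.

Lemma theta_sumSr m n : theta_sum m n.+1 = - (1 - b * Q ^+ n) * theta_sum m n.
Proof.
rewrite mulNr mulrBl mul1r opprB {1}/theta_sum addnS {1}(theta_sum_widen m n).
rewrite big_ord_recl [in RHS]big_ord_recl !gauss0 mulrDr -addrA; congr (_ + _).
  by rewrite /theta_wt !sub0n !subn0 !binS2 exprMn !(exprD, exprS); ring.
rewrite /theta_sum mulr_sumr -sumrB.
apply: eq_bigr => k _; rewrite lift0 gaussS theta_wtSl exprS.
have wE := theta_wt_step_b n k.
rewrite mulrDr [_ * (Q ^+ k.+1 * _)]mulrA -[_ * Q ^+ k.+1]mulrA.
rewrite (mulrC _ (Q ^+ k.+1)) wE; ring.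
Qed.

(** Each factor is added by one Pascal rule. The sign [(-1) ^+ n] appears because the summands carry
    [(-1) ^+ k], not the sign of the centred index [k - n]. *)
Lemma finite_triple_product m n :
  theta_sum m n =
  (-1) ^+ n * \prod_(i < m) (1 - a * Q ^+ i) * \prod_(i < n) (1 - b * Q ^+ i).
Proof.
elim: n => [|n IH]; last by rewrite theta_sumSr IH big_ord_recr exprS /=; ring.
elim: m => [|m IH].
  by rewrite /theta_sum /theta_wt !big_ord_recl !big_ord0 /= !bin_small // !expr0; ring.
by rewrite theta_sumSl IH big_ord_recr /=; ring.
Qed.
End FiniteTripleProduct.

(** * Theta series and Gordon's functions with nilpotent [q] *)

Section NilpotentBase.
Variables (R : comNzRingType) (q : R) (N : nat).
Hypothesis qN0 : q ^+ N = 0.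

Lemma expr_nil k : (N <= k)%N -> q ^+ k = 0.
Proof. by move=> Nk; rewrite -(subnK Nk) exprD qN0 mulr0. Qed.

Lemma mul_geom i : (0 < i)%N -> (1 - q ^+ i) * (\sum_(k < N) q ^+ (i * k)) = 1.
Proof.
move=> i0; transitivity (1 - (q ^+ i) ^+ N).
  rewrite -[RHS]opprB subrX1 -mulNr opprB; congr (_ * _).
  by apply: eq_bigr => k _; rewrite exprM.
by rewrite -exprM expr_nil ?subr0 // leq_pmull.
Qed.

(** Cancelling such factors takes the place of division in what follows. *)
Lemma lreg_1subX i : (0 < i)%N -> GRing.lreg (1 - q ^+ i).
Proof.
move=> i0 x y /(congr1 (fun z => (\sum_(k < N) q ^+ (i * k)) * z)).
by rewrite !mulrA ![(\sum_(k < N) _) * _]mulrC mul_geom // !mul1r.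
Qed.

Lemma lreg_prod (I : Type) (r : seq I) (P : pred I) (F : I -> R) :
  (forall i, P i -> GRing.lreg (F i)) -> GRing.lreg (\prod_(i <- r | P i) F i).
Proof.
move=> Freg; apply: big_ind => //; first exact: lreg1.
by move=> x y; apply: lregM.
Qed.

Lemma lreg_qpoch e n : (0 < e)%N -> GRing.lreg (qpoch (q ^+ e) n).
Proof.
move=> e0; apply: lreg_prod => i _; rewrite -exprM; apply: lreg_1subX; lia.
Qed.

Lemma qpoch_stable e n : (0 < e)%N -> (N <= n)%N ->
  qpoch (q ^+ e) n = qpoch (q ^+ e) N.
Proof.
move=> e0; elim: n => [|n IH] Nn; first by have -> : N = 0%N by lia.
have [->//|nN] := eqVneq n.+1 N.
have en0 : (q ^+ e) ^+ n.+1 = 0 by rewrite -exprM expr_nil //; nia.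
by rewrite qpochS en0 subr0 mulr1 IH //; lia.
Qed.

(** This is the limit of [gauss], the inverse of [(Q; Q)_oo]: all three products in [gauss_qpoch]
    have stabilised, and one copy cancels. *)
Lemma qpoch_mul_gauss e m k : (0 < e)%N -> (N <= k)%N -> (N <= m - k)%N ->
  qpoch (q ^+ e) N * gauss (q ^+ e) m k = 1.
Proof.
move=> e0 Nk Nmk; have [km|mk] := leqP k m; last first.
  (* For [m < k] the truncated [m - k] is 0, which forces [N = 0] and hence [1 = 0] in a nonzero
     ring. *)
  have N0 : N = 0%N by lia.
  by have := qN0; rewrite N0 expr0 => /eqP; rewrite oner_eq0.
apply: (@lreg_qpoch e N e0).
have := gauss_qpoch (q ^+ e) km; rewrite !qpoch_stable //; last by lia.
by rewrite mulr1 mulrA.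
Qed.

Lemma sum_center (F : nat -> R) M :
  \sum_(k < (M.+1 + M).+1) F k = \sum_(r < M.+1) (F (M - r)%N + F (M.+1 + r)%N).
Proof.
rewrite -addnS big_split_ord big_split /=; congr (_ + _).
by rewrite (reindex_inj rev_ord_inj); apply: eq_bigr => i _ /=; rewrite subSS.
Qed.

Lemma sum_nil_widen (F : nat -> R) M : (N <= M)%N ->
  (forall r, (N <= r)%N -> F r = 0) -> \sum_(r < M) F r = \sum_(r < N) F r.
Proof.
move=> NM F0; rewrite -(big_mkord predT F) (big_cat_nat (n := N)) //= big_mkord.
rewrite [X in _ + X = _]big_nat_cond [X in _ + X]big1 ?addr0 // => r.
by move=> /andP[/andP[/F0]].
Qed.

(** Jacobi's triple product in base [q^7], with the centred indices [-r] and [r + 1] paired; their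
    weights differ by the factor [q^(6r+3)] and their signs are opposite. *)
Lemma theta_product :
  \prod_(i < N.*2) ((1 - q ^+ (7 * i + 3)) * (1 - q ^+ (7 * i + 4)) *
                    (1 - q ^+ (7 * i + 7))) =
  \sum_(r < N) (-1) ^+ r * q ^+ (7 * 'C(r, 2) + 4 * r) * (1 - q ^+ (6 * r + 3)).
Proof.
have QE : q ^+ 3 * q ^+ 4 = q ^+ 7 by rewrite -exprD.
(* The unequal lengths give an even number of terms, as [sum_center] needs, and the extra factor is
   1. Lengths near [2N] keep both indices of each pair with [r < N] at distance at least [N] from
   the ends, where [qpoch_mul_gauss] applies. *)
have := finite_triple_product (q ^+ 3) (q ^+ 4) N.*2.+1 N.*2.
have top0 : q ^+ 3 * (q ^+ 7) ^+ N.*2 = 0.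
  by rewrite -exprM -exprD expr_nil //; lia.
rewrite big_ord_recr /= QE top0 subr0 mulr1.
rewrite -signr_odd odd_double expr0 mul1r => prodE.
have {prodE} -> : \prod_(i < N.*2) ((1 - q ^+ (7 * i + 3)) * (1 - q ^+ (7 * i + 4)) *
                    (1 - q ^+ (7 * i + 7)))
  = qpoch (q ^+ 7) N * theta_sum (q ^+ 3) (q ^+ 4) N.*2.+1 N.*2.
  rewrite prodE !big_split /= mulrC -(@qpoch_stable 7 N.*2) //; last by lia.
  congr (_ * (_ * _)); apply: eq_bigr => i _; rewrite -?exprM -?exprD; congr (1 - q ^+ _); lia.
rewrite /theta_sum QE mulr_sumr.
rewrite (sum_center (fun k => qpoch (q ^+ 7) N *
  ((-1) ^+ k * theta_wt (q ^+ 3) (q ^+ 4) N.*2 k * gauss (q ^+ 7) (N.*2.+1 + N.*2) k))).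
pose e r := (7 * 'C(r, 2) + 4 * r)%N.
have wtl r : (r <= N.*2)%N -> theta_wt (q ^+ 3) (q ^+ 4) N.*2 (N.*2 - r) = q ^+ e r.
  move=> rN; rewrite /theta_wt (_ : N.*2 - r - N.*2 = 0)%N ?subKn //; last by lia.
  by rewrite -!exprM -exprD !binS2 /e bin0n; congr (_ ^+ _); lia.
have wtr r : theta_wt (q ^+ 3) (q ^+ 4) N.*2 (N.*2.+1 + r) = q ^+ e r * q ^+ (6 * r + 3).
  have -> : (N.*2.+1 + r = N.*2 + r.+1)%N by rewrite addnS.
  rewrite /theta_wt addKn (_ : N.*2 - (N.*2 + r.+1) = 0)%N; last by lia.
  rewrite -!exprM -!exprD; congr (_ ^+ _); rewrite /e !binS2 bin0n /=; lia.
have er r : (r <= e r)%N by rewrite /e; lia.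
rewrite -[RHS](@sum_nil_widen (fun r => (-1) ^+ r * q ^+ e r * (1 - q ^+ (6 * r + 3)))
  N.*2.+1); [|lia|]; last first.
  by move=> r Nr; rewrite (@expr_nil (e r)) ?mulr0 ?mul0r // (leq_trans Nr) // er.
apply: eq_bigr => r _; have rN : (r <= N.*2)%N := ltn_ord r.
rewrite wtl // wtr.
have [Nr|rlN] := leqP N r.
  by rewrite (@expr_nil (e r)) ?(leq_trans Nr) //; ring.
have inv k : (N <= k)%N -> (k <= N.*2.+1 + N)%N ->
    forall x, qpoch (q ^+ 7) N * (x * gauss (q ^+ 7) (N.*2.+1 + N.*2) k) = x.
  by move=> Nk kN x; rewrite mulrCA qpoch_mul_gauss ?mulr1 //; lia.
rewrite inv; [|lia|lia]; rewrite inv; [|lia|lia].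
have -> : (-1) ^+ (N.*2 - r) = (-1) ^+ r :> R.
  by rewrite -signr_odd oddB // odd_double signr_odd.
by rewrite exprD exprS -(signr_odd _ N.*2) odd_double; ring.
Qed.
End NilpotentBase.

Section GordonSeries.
Variables (R : comNzRingType) (q : R) (N : nat).
Hypothesis qN0 : q ^+ N = 0.

(* The series of (q x; q)_oo J_(3,i)(x) at [x = q ^+ m], where J_(k,i) are Gordon's
   functions; the Gaussian binomial stands for (q x; q)_r / (q; q)_r. *)
Definition gordon_term (i m r : nat) : R :=
  (-1) ^+ r * q ^+ (3 * m * r + 7 * 'C(r, 2) + (7 - i) * r) *
  (1 - q ^+ ((m + r.*2.+1) * i)) * gauss q (m + r) r.

Definition gordon i m : R := \sum_(r < N) gordon_term i m r.

(** Gordon's relation between [J_(3,j+1)(x)], [J_(3,j)(x)] and [J_(3,3-j)(xq)]; the factor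
    [1 - q ^+ m.+1] comes from the normalisation by [(q x; q)_oo]. The difference of terms splits
    into [lo] and [hi], and [lo] at [r.+1] joins [hi] at [r] to form one term at [m.+1]. *)
Lemma gordon_step j m : (j <= 2)%N ->
  gordon j.+1 m = gordon j m + q ^+ (m.+1 * j) * (1 - q ^+ m.+1) * gordon (3 - j) m.+1.
Proof.
move=> j2.
pose c r := (-1) ^+ r * q ^+ (3 * m * r + 7 * 'C(r, 2)).
pose lo r := c r * q ^+ ((6 - j) * r) * (1 - q ^+ r) * gauss q (m + r) r.
pose hi r := c r * q ^+ ((7 - j) * r + (m + r.*2.+1) * j) *
             (1 - q ^+ (m + r).+1) * gauss q (m + r) r.
have split_term r : gordon_term j.+1 m r = gordon_term j m r + lo r + hi r.
  rewrite /gordon_term /lo /hi /c.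
  have -> : q ^+ (3 * m * r + 7 * 'C(r, 2) + (7 - j.+1) * r) =
            q ^+ (3 * m * r + 7 * 'C(r, 2)) * q ^+ ((6 - j) * r).
    by rewrite -exprD; congr (_ ^+ _); lia.
  have -> : q ^+ (3 * m * r + 7 * 'C(r, 2) + (7 - j) * r) =
            q ^+ (3 * m * r + 7 * 'C(r, 2)) * q ^+ ((6 - j) * r) * q ^+ r.
    by rewrite -!exprD; congr (_ ^+ _); nia.
  have -> : q ^+ ((7 - j) * r + (m + r.*2.+1) * j) =
            q ^+ ((6 - j) * r) * q ^+ r * q ^+ ((m + r.*2.+1) * j).
    by rewrite -!exprD; congr (_ ^+ _); nia.
  have -> : q ^+ ((m + r.*2.+1) * j.+1) =
            q ^+ ((m + r.*2.+1) * j) * (q ^+ r * q ^+ (m + r).+1).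
    by rewrite -!exprD; congr (_ ^+ _); nia.
  ring.
have lo0 : lo 0%N = 0 by rewrite /lo expr0 subrr mulr0 mul0r.
have loN : lo N = 0.
  rewrite /lo (@expr_nil _ q N qN0 ((6 - j) * N)) ?mulr0 ?mul0r //; nia.
(* The index of [lo] can be shifted since [lo] vanishes at both ends: at 0 by its factor
   [1 - q ^+ r], at [N] by nilpotency. *)
have shift : \sum_(r < N) lo r = \sum_(r < N) lo r.+1.
  have : \sum_(r < N.+1) lo r = \sum_(r < N.+1) lo r by [].
  by rewrite {1}big_ord_recr [in RHS]big_ord_recl /= lo0 loN addr0 add0r.
transitivity (gordon j m + \sum_(r < N) (lo r.+1 + hi r)).
  rewrite big_split /= -shift /gordon -!big_split; apply: eq_bigr => r _ /=.
  by rewrite split_term addrA.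
congr (_ + _); rewrite [in RHS]mulr_sumr; apply: eq_bigr => r _.
rewrite /lo /hi /gordon_term.
have loE : (1 - q ^+ r.+1) * gauss q (m + r.+1) r.+1 =
           (1 - q ^+ m.+1) * gauss q (m.+1 + r) r.
  by rewrite addnS -addSn gauss_shift addSn subSn ?leq_addl // addnK.
have hiE : (1 - q ^+ (m + r).+1) * gauss q (m + r) r =
           (1 - q ^+ m.+1) * gauss q (m.+1 + r) r.
  by rewrite -gauss_absorb_compl ?leq_addl // subSn ?leq_addl // addnK.
rewrite -!mulrA loE hiE /c.
rewrite exprS binS2.
pose X := (-1) ^+ r * (1 - q ^+ m.+1) * gauss q (m.+1 + r) r.
pose a := q ^+ (m.+1 * j) * q ^+ (3 * m.+1 * r + 7 * 'C(r, 2) + (7 - (3 - j)) * r).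
rewrite [RHS](_ : _ = X * (a - a * q ^+ ((m.+1 + r.*2.+1) * (3 - j)))); last first.
  by rewrite /X /a; ring.
rewrite [LHS](_ : _ = X *
  (q ^+ (3 * m * r + 7 * 'C(r, 2)) * q ^+ ((7 - j) * r + (m + r.*2.+1) * j) -
   q ^+ (3 * m * r.+1 + 7 * ('C(r, 2) + r)) * q ^+ ((6 - j) * r.+1))); last first.
  by rewrite /X; ring.
congr (_ * _); rewrite /a -!exprD.
have [->|[->|->]] : (j = 0 \/ j = 1 \/ j = 2)%N by lia.
all: by congr (q ^+ _ - q ^+ _); nia.
Qed.

Lemma gordon0 m : gordon 0 m = 0.
Proof. by apply: big1 => r _; rewrite /gordon_term muln0 expr0 subrr mulr0 mul0r. Qed.

Lemma gordon_large i m : (0 < i <= 7)%N -> (N <= m)%N -> gordon i m = 1.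
Proof.
move=> i0 Nm; have := qN0.
case EN : N => [|M] qM; first by move: qM; rewrite expr0 => /eqP; rewrite oner_eq0.
rewrite /gordon EN big_ord_recl big1 => [|r _].
  rewrite /gordon_term !bin0n gauss0 !muln0 expr0 !mul1r (@expr_nil _ q N qN0); last by nia.
  by rewrite subr0 addr0 !mulr1.
rewrite /gordon_term lift0 (@expr_nil _ q N qN0 (_ + _ + _)) ?mulr0 ?mul0r //; nia.
Qed.
End GordonSeries.

(** * Tilings *)

Fixpoint subseqs (T : Type) (s : seq T) : seq (seq T) :=
  if s is x :: s' then subseqs s' ++ map (cons x) (subseqs s') else [:: [::]].

Lemma mem_subseqs (T : eqType) (s t : seq T) : (t \in subseqs s) = subseq t s.
Proof.
elim: s t => [|x s IH] t /=; first by rewrite inE.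
rewrite mem_cat IH; case: t => [|y t]; first by rewrite sub0seq.
have [->|yx] := eqVneq y x.
  rewrite (mem_map (fun _ _ => @congr1 _ _ behead (_ :: _) (_ :: _))) IH orbC.
  by apply/orb_idr => /(subseq_trans (subseq_cons t x)).
by rewrite (negPf (_ : _ \notin _)) ?orbF //; apply/mapP => -[u _ [/eqP]]; rewrite (negPf yx).
Qed.

Lemma subseqs_uniq (T : eqType) (s : seq T) : uniq s -> uniq (subseqs s).
Proof.
elim: s => //= x s IH /andP[xs /IH us].
rewrite cat_uniq us map_inj_uniq ?us ?andbT => [|? ? []//].
apply/hasPn => _ /mapP[t _ ->]; rewrite mem_subseqs.
by apply: contra xs => /mem_subseq ->; rewrite ?mem_head.
Qed.

(** Half of the gap 4. Neighbouring tiles may thus share one blocked position when [c = 0], but are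
    disjoint when [c = 1]. *)
Definition gap2 : rel nat := fun x y => (x + 2 <= y)%N.

(* [hs] lists the e_j / 2; with [s = 0], the shift [c = 0] gives the exclusions of B
   and [c = 1] those of C. *)
Fixpoint covered (c s : nat) (hs : seq nat) (i : nat) : bool :=
  if hs is h :: hs' then (h + s <= i <= h + s + 2)%N || covered c (s + c) hs' i
  else false.

Lemma covered_lt c s m hs i :
  all (leq m) hs -> (i < m + s)%N -> covered c s hs i = false.
Proof.
elim: hs s => //= h hs IH s /andP[mh mhs] im.
by rewrite IH //; lia.
Qed.

Definition tilings (N m : nat) : seq (seq nat) :=
  [seq hs <- subseqs (iota m (N - m)) | sorted gap2 hs].

Lemma tilings_ge N m hs : hs \in tilings N m -> all (leq m) hs.
Proof.
rewrite mem_filter mem_subseqs => /andP[_ /mem_subseq sub].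
by apply/allP => x /sub; rewrite mem_iota => /andP[].
Qed.

Lemma tilings_large N m : (N <= m)%N -> tilings N m = [:: [::]].
Proof. by move=> Nm; rewrite /tilings (_ : N - m = 0)%N //; lia. Qed.

Lemma path_gap2 m hs : all (leq m.+2) hs -> path gap2 m hs = sorted gap2 hs.
Proof. by case: hs => //= h hs /andP[mh _]; rewrite /gap2 addn2 mh. Qed.

(** Starting from [m >= N], where [q ^+ m] vanishes, replaces the initial condition at x = 0 of a
    q-difference equation. *)
Lemma descending_ind (N : nat) (P : nat -> Prop) :
  (forall m, (N <= m)%N -> P m) ->
  (forall m, (m < N)%N -> (forall k, (m < k)%N -> P k) -> P m) ->
  forall m, P m.
Proof.
move=> large step m; have [n] := ubnP (N - m); elim: n m => // n IH m nm.
have [/large//|mN] := leqP N m.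
by apply: step => // k mk; apply: IH; lia.
Qed.

(** * Generating functions of tilings: recursions, closed forms and product *)

Section TilingSums.
Variables (R : comNzRingType) (q : R) (N : nat).
Hypothesis qN0 : q ^+ N = 0.

(** The sum is split on whether [m] carries a tile. For [m >= N] no tile can be placed there, so the
    hypothesis makes the extra term zero and the rule holds without a boundary case. *)
Lemma tilings_split (P : pred nat) (F : seq nat -> R) m :
  ((N <= m)%N -> forall hs, F (m :: hs) = 0) ->
  \sum_(hs <- tilings N m | P (size hs)) F hs =
  \sum_(hs <- tilings N m.+1 | P (size hs)) F hs +
  \sum_(hs <- tilings N m.+2 | P (size hs).+1) F (m :: hs).
Proof.
move=> F0; have [Nm|mN] := leqP N m.
  rewrite [X in _ = _ + X]big1 => [|hs _]; last exact: F0.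
  by rewrite addr0 (tilings_large Nm) (tilings_large (leqW Nm)).
rewrite {1}/tilings (_ : N - m = (N - m.+1).+1)%N; last by lia.
rewrite /= filter_cat big_cat /=; congr (_ + _).
rewrite filter_map big_map !big_filter_cond.
have [Nm|mN1] := leqP N m.+1.
  have [-> ->] : (N - m.+1 = 0 /\ N - m.+2 = 0)%N by lia.
  by rewrite /= !big_cons !big_nil.
rewrite (_ : N - m.+1 = (N - m.+2).+1)%N; last by lia.
(* A tile at [m.+1] right after one at [m] violates the gap, so that half of the sum is empty. *)
rewrite /= big_cat /= big_map /= [X in _ + X]big_pred0 ?addr0 => [|hs]; last first.
  by rewrite /gap2 addn2 ltnn.
rewrite big_seq_cond [RHS]big_seq_cond.
apply: eq_bigl => hs /=; have [hsub|//] := boolP (hs \in _).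
rewrite path_gap2 //; apply/allP => x; move: hsub; rewrite mem_subseqs => /mem_subseq sub /sub.
by rewrite mem_iota => /andP[].
Qed.

Definition free_prod (c s : nat) (hs : seq nat) (a : nat) : R :=
  \prod_(a <= i < N | ~~ covered c s hs i) (1 + q ^+ i).

(** [a] and [m] are the least positions open to lambda and to tiles, [s] is the shift accumulated so
    far, and [P] restricts the number of tiles. The exponent is doubled since tiles are halved parts
    of pi. *)
Definition tiling_sum (c : nat) (P : pred nat) (s a m : nat) : R :=
  \sum_(hs <- tilings N m | P (size hs)) q ^+ (2 * sumn hs) * free_prod c s hs a.

Lemma eq_tiling_sum c P P' s a m :
  P =1 P' -> tiling_sum c P s a m = tiling_sum c P' s a m.
Proof. by move=> PP; apply: eq_bigl => hs; rewrite PP. Qed.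

(** A tile at [m] blocks [m + s], [m + s + 1] and [m + s + 2]; for [a] in the given range, the
    positions left to lambda then start at [m + s + 3]. *)
Lemma tiling_sum_rec c P s a m : (m + s <= a <= m + s + 3)%N ->
  tiling_sum c P s a m = tiling_sum c P s a m.+1 +
    q ^+ (2 * m) * tiling_sum c (P \o succn) (s + c) (m + s + 3) m.+2.
Proof.
move=> /andP[msa am].
rewrite /tiling_sum (tilings_split P (F := fun hs => _ * free_prod c s hs a)).
  congr (_ + _); rewrite mulr_sumr; apply: eq_bigr => hs _ /=.
  rewrite mulnDr exprD mulrA; congr (_ * _).
  rewrite /free_prod [RHS](big_nat_widenl _ a) // big_nat_cond [RHS]big_nat_cond.
  apply: eq_bigl => i /=; have [/andP[ai _]|//] := boolP (a <= i < N)%N.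
  rewrite /= negb_or andbC; congr (_ && _).
  by rewrite (leq_trans msa ai) -ltnNge addn3 addn2.
by move=> Nm hs /=; rewrite (expr_nil qN0) ?mul0r //; lia.
Qed.

Lemma tiling_sum_site c P s a m : (a < m + s)%N ->
  tiling_sum c P s a m = (1 + q ^+ a) * tiling_sum c P s a.+1 m.
Proof.
move=> am; rewrite /tiling_sum mulr_sumr big_seq_cond [RHS]big_seq_cond.
apply: eq_bigr => hs /andP[/tilings_ge mhs _]; rewrite mulrCA; congr (_ * _).
rewrite /free_prod; have [Na|aN] := leqP N a.
  by rewrite !big_geq ?(expr_nil qN0) ?addr0 ?mul1r //; lia.
by rewrite big_ltn_cond // (covered_lt _ mhs am).
Qed.

(** The product [(-q^a; q)_oo], whose factors from [q ^+ N] on are 1. *)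
Definition free_tail (a : nat) : R := \prod_(a <= i < N) (1 + q ^+ i).

Lemma free_tailS a : free_tail a = (1 + q ^+ a) * free_tail a.+1.
Proof.
rewrite /free_tail; have [Na|aN] := leqP N a; last by rewrite big_ltn.
by rewrite !big_geq ?(expr_nil qN0) ?addr0 ?mul1r //; lia.
Qed.

Lemma tiling_sum_large c (P : pred nat) s a m : (N <= m)%N ->
  (N <= a)%N -> tiling_sum c P s a m = (P 0)%:R.
Proof.
move=> Nm Na; rewrite /tiling_sum tilings_large // big_cons big_nil /=.
by case: (P 0); rewrite // /free_prod big_geq // muln0 expr0 mulr1 addr0.
Qed.

(** With [c = 1] the next tile, at [m.+2] or later, blocks nothing before [m + s + 3], exactly where
    lambda resumes, so the recursion closes on sums of this shape. *)
Lemma tiling_sumC P s m :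
  tiling_sum 1 P s (m + s) m =
  (1 + q ^+ (m + s)) * tiling_sum 1 P s (m.+1 + s) m.+1 +
  q ^+ (2 * m) * tiling_sum 1 (P \o succn) s.+1 (m.+2 + s.+1) m.+2.
Proof.
rewrite tiling_sum_rec; last by lia.
rewrite tiling_sum_site // addn1.
by rewrite (_ : m + s + 3 = m.+2 + s.+1)%N //; lia.
Qed.

Definition tilingB P m := tiling_sum 0 P 0 m m.

(** With [c = 0], after a tile at [m] the tiles resume at [m.+2] but lambda only at [m.+3].
    Expanding this off-diagonal sum and [tilingB] at [m.+2] yields the same last term; eliminating
    it gives the difference in brackets. *)
Lemma tilingB_rec P m :
  tilingB P m = (1 + q ^+ m) * tilingB P m.+1 +
    q ^+ (2 * m) * (tilingB (P \o succn) m.+2 -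
                    q ^+ m.+2 * tilingB (P \o succn) m.+3).
Proof.
have step P' k : tilingB P' k = (1 + q ^+ k) * tilingB P' k.+1 +
    q ^+ (2 * k) * tiling_sum 0 (P' \o succn) 0 k.+3 k.+2.
  rewrite {1}/tilingB tiling_sum_rec; last by lia.
  by rewrite tiling_sum_site ?addn0 // addn3.
rewrite step; congr (_ + _ * _).
rewrite tiling_sum_rec; last by lia.
rewrite (step _ m.+2) !addn0 addn3 /tilingB; ring.
Qed.
Lemma tiling_sum_size c s a m :
  tiling_sum c predT s a m = \sum_(n < N.+1) tiling_sum c (pred1 (n : nat)) s a m.
Proof.
rewrite /tiling_sum (partition_big (fun hs => inord (size hs) : 'I_N.+1) predT) //=.
apply: eq_bigr => n _; rewrite big_seq_cond [RHS]big_seq_cond.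
apply: eq_bigl => hs; have [|//] := boolP (hs \in _).
rewrite mem_filter mem_subseqs => /andP[_ /size_subseq]; rewrite size_iota => sz.
by rewrite -val_eqE /= inordK // ltnS (leq_trans sz) // leq_subr.
Qed.

(* For [a = m]: the Rogers-Selberg summand at x = q^(m-1), times (q^2; q^2)_n. *)
Definition rs_term n m a : R := q ^+ (2 * n * n.-1 + 2 * n * m) * free_tail (a + n.*2).

Lemma rs_term_large n m a : (N <= m)%N -> (N <= a)%N ->
  rs_term n m a = (pred1 n 0%N)%:R.
Proof.
move=> Nm Na; case: n => [|n]; rewrite /rs_term /=.
  by rewrite !muln0 !mul0n expr0 mul1r /free_tail big_geq //; lia.
by rewrite (expr_nil qN0) ?mul0r //; nia.
Qed.

(** Without common factors this is [1 + x y = (1 + x) y + (1 - y)], where [x = q^a] and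
    [y = q^(2n+2)]. *)
Lemma rs_termS n m a :
  rs_term n.+1 m a = (1 + q ^+ a) * rs_term n.+1 m.+1 a.+1 +
    q ^+ (2 * m) * (1 - q ^+ (2 * n.+1)) * rs_term n m.+2 (a.+3).
Proof.
rewrite /rs_term (_ : a + n.+1.*2 = a + n.*2.+2)%N; last by lia.
rewrite (_ : a.+1 + n.+1.*2 = (a + n.*2.+2).+1)%N; last by lia.
rewrite (_ : a.+3 + n.*2 = (a + n.*2.+2).+1)%N; last by lia.
rewrite [in LHS]free_tailS.
rewrite (_ : q ^+ (a + n.*2.+2) = q ^+ a * q ^+ (2 * n.+1)); last first.
  by rewrite -exprD; congr (_ ^+ _); lia.
rewrite (_ : q ^+ (2 * n.+1 * n.+1.-1 + 2 * n.+1 * m) =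
             q ^+ (2 * m) * q ^+ (2 * n * n.-1 + 2 * n * m.+2)); last first.
  by rewrite -exprD; congr (_ ^+ _); case: n => [|n] /=; nia.
rewrite (_ : q ^+ (2 * n.+1 * n.+1.-1 + 2 * n.+1 * m.+1) =
  q ^+ (2 * n.+1) * (q ^+ (2 * m) * q ^+ (2 * n * n.-1 + 2 * n * m.+2))); last first.
  by rewrite -!exprD; congr (_ ^+ _); case: n => [|n] /=; nia.
ring.
Qed.

Lemma rs_term0 m a : rs_term 0 m a = (1 + q ^+ a) * rs_term 0 m.+1 a.+1.
Proof.
by rewrite /rs_term /= !muln0 !mul0n !addn0 free_tailS; ring.
Qed.

Lemma tiling_sum_pred0 c s a m : tiling_sum c (pred1 0%N \o succn) s a m = 0.
Proof. exact: big_pred0. Qed.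

Lemma qpoch2S n : qpoch (q ^+ 2) n.+1 = qpoch (q ^+ 2) n * (1 - q ^+ (2 * n.+1)).
Proof. by rewrite qpochS exprM. Qed.

(** Both sides obey the same recursion, the factor [1 - q^(2n+2)] of [rs_termS] being the ratio of
    consecutive [qpoch]. Induction runs over [n] with [s] free, as a tile raises [s], and then
    downwards over [m]. *)
Lemma tiling_sumC_closed n s m :
  qpoch (q ^+ 2) n * tiling_sum 1 (pred1 n) s (m + s) m = rs_term n m (m + s).
Proof.
elim: n s m => [|n IHn] s; elim/(descending_ind (N := N)) => m.
- by move=> Nm; rewrite tiling_sum_large ?rs_term_large ?/qpoch ?big_ord0 ?mul1r //; lia.
- move=> _ IH; rewrite tiling_sumC tiling_sum_pred0 mulr0 addr0.
  by rewrite mulrCA IH // [RHS]rs_term0.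
- by move=> Nm; rewrite tiling_sum_large ?rs_term_large ?mulr0 //; lia.
move=> _ IH; rewrite tiling_sumC rs_termS mulrDr mulrCA IH // addSn.
rewrite (_ : (m + s).+3 = m.+2 + s.+1)%N; last by lia.
by rewrite -IHn qpoch2S (@eq_tiling_sum _ (pred1 n.+1 \o succn) (pred1 n)) //; ring.
Qed.

Lemma tilingB_closed n m : qpoch (q ^+ 2) n * tilingB (pred1 n) m = rs_term n m m.
Proof.
elim: n m => [|n IHn]; elim/(descending_ind (N := N)) => m.
- by move=> Nm; rewrite /tilingB tiling_sum_large ?rs_term_large ?/qpoch ?big_ord0 ?mul1r.
- move=> _ IH; rewrite tilingB_rec /tilingB !tiling_sum_pred0 !mulr0 subr0 mulr0 addr0.
  by rewrite mulrCA IH // [RHS]rs_term0.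
- by move=> Nm; rewrite /tilingB tiling_sum_large ?rs_term_large ?mulr0.
move=> _ IH; rewrite tilingB_rec rs_termS mulrDr mulrCA IH //.
have tB k : qpoch (q ^+ 2) n * tilingB (pred1 n.+1 \o succn) k = rs_term n k k.
  by rewrite -IHn /tilingB (@eq_tiling_sum _ (pred1 n.+1 \o succn) (pred1 n)).
congr (_ + _); rewrite qpoch2S.
transitivity (q ^+ (2 * m) * (1 - q ^+ (2 * n.+1)) *
  (rs_term n m.+2 m.+2 - q ^+ m.+2 * rs_term n m.+3 m.+3)).
  by rewrite -!tB; ring.
(* The bracket of the B-recursion collapses to [rs_term n m.+2 m.+3], because [(1 + q^(m+2) q^(2n))
   - q^(m+2) q^(2n) = 1]. This is the term that [rs_termS] asks for. *)
congr (_ * _); rewrite /rs_term (_ : m.+3 + n.*2 = (m.+2 + n.*2).+1)%N; last by lia.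
rewrite free_tailS (_ : q ^+ (m.+2 + n.*2) = q ^+ m.+2 * q ^+ (2 * n)); last first.
  by rewrite -exprD; congr (_ ^+ _); lia.
rewrite (_ : q ^+ (2 * n * n.-1 + 2 * n * m.+3) =
  q ^+ (2 * n) * q ^+ (2 * n * n.-1 + 2 * n * m.+2)); last first.
  by rewrite -exprD; congr (_ ^+ _); lia.
ring.
Qed.

Lemma tiling_sum_B_C : tiling_sum 0 predT 0 1 1 = tiling_sum 1 predT 0 1 1.
Proof.
rewrite !tiling_sum_size; apply: eq_bigr => n _.
apply: (lreg_qpoch qN0 (e := 2) (n := n)) => //.
by rewrite [LHS]tilingB_closed (tiling_sumC_closed n 0 1).
Qed.

(** The two formulas are proved together: [gordon_step] at [j = 0] eliminates [J_(3,1)], [j = 1]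
    with [tilingB_rec] gives the second formula, and [j = 2] then gives the first. *)
Lemma gordon_tilingB m (T := \prod_(m <= i < N) (1 - q ^+ i.+1)) :
  gordon q N 3 m = T * tilingB predT m.+1 /\
  gordon q N 2 m = T * (tilingB predT m.+1 - q ^+ (2 * m.+1) * tilingB predT m.+3).
Proof.
have TS k : \prod_(k <= i < N) (1 - q ^+ i.+1) =
    (1 - q ^+ k.+1) * \prod_(k.+1 <= i < N) (1 - q ^+ i.+1).
  have [Nk|kN] := leqP N k; last by rewrite big_ltn.
  by rewrite !big_geq ?(expr_nil qN0) ?subr0 ?mul1r //; lia.
rewrite {}/T; elim/(descending_ind (N := N)): m => m.
  move=> Nm; rewrite big_geq // !(gordon_large qN0) // /tilingB !tiling_sum_large //; try lia.
  by rewrite (expr_nil qN0) ?mul0r ?subr0 ?mul1r //; lia.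
move=> _ IH.
have [_ IH2] := IH m.+1 (ltnSn m); have [IH3 _] := IH m.+2 (leqnSn m.+1).
have g1 k : gordon q N 1 k = (1 - q ^+ k.+1) * gordon q N 3 k.+1.
  by rewrite (gordon_step qN0) // gordon0 add0r muln0 expr0 mul1r.
have g2 : gordon q N 2 m = \prod_(m <= i < N) (1 - q ^+ i.+1) *
    (tilingB predT m.+1 - q ^+ (2 * m.+1) * tilingB predT m.+3).
  have [IH31 _] := IH m.+1 (ltnSn m).
  rewrite (gordon_step qN0) // g1 IH31 IH2 (tilingB_rec _ m.+1) muln1.
  rewrite (TS m).
  rewrite (_ : q ^+ (2 * m.+2) = q ^+ m.+1 * q ^+ m.+3); last first.
    by rewrite -exprD; congr (_ ^+ _); lia.
  rewrite (_ : q ^+ (2 * m.+1) = q ^+ m.+1 * q ^+ m.+1); last first.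
    by rewrite -exprD; congr (_ ^+ _); lia.
  ring.
split=> //.
rewrite (gordon_step qN0) // g2 g1 IH3 (mulnC m.+1 2) (TS m) (TS m.+1); ring.
Qed.

Lemma tiling_sum_product :
  tilingB predT 1 * \prod_(i < N.*2) ((1 - q ^+ (7 * i + 1)) * (1 - q ^+ (7 * i + 2)) *
    (1 - q ^+ (7 * i + 5)) * (1 - q ^+ (7 * i + 6))) = 1.
Proof.
have [g _] := gordon_tilingB 0.
have gE : gordon q N 3 0 = \prod_(i < N.*2) ((1 - q ^+ (7 * i + 3)) * (1 - q ^+ (7 * i + 4)) *
                    (1 - q ^+ (7 * i + 7))).
  rewrite (theta_product qN0); apply: eq_bigr => r _; rewrite /gordon_term.
  have gauss_diag k : gauss q k k = 1 by elim: k => //= k ->; rewrite gauss_small // mulr0 addr0.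
  rewrite gauss_diag mulr1 muln0 mul0n !add0n.
  by congr (_ * _ * (1 - q ^+ _)); lia.
(* By stability the product may run over [N.*2] full periods mod 7, and so splits by residue. *)
have E : \prod_(0 <= i < N) (1 - q ^+ i.+1) = \prod_(i < 7 * N.*2) (1 - q ^+ i.+1).
  rewrite big_mkord; have := qpoch_stable qN0 (n := 7 * N.*2) (ltn0Sn 0).
  by rewrite /qpoch !expr1 => -> //; lia.
have E7 n : \prod_(i < 7 * n) (1 - q ^+ i.+1) =
    \prod_(i < n) ((1 - q ^+ (7 * i + 1)) * (1 - q ^+ (7 * i + 2)) *
    (1 - q ^+ (7 * i + 5)) * (1 - q ^+ (7 * i + 6))) *
    \prod_(i < n) ((1 - q ^+ (7 * i + 3)) * (1 - q ^+ (7 * i + 4)) * (1 - q ^+ (7 * i + 7))).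
  elim: n => [|n IH]; first by rewrite muln0 !big_ord0 mulr1.
  rewrite mulnS addnC !addnS addn0 !big_ord_recr /= IH !addnS !addn0; ring.
rewrite gE E E7 in g.
have reg : GRing.lreg (\prod_(i < N.*2) ((1 - q ^+ (7 * i + 3)) * (1 - q ^+ (7 * i + 4)) *
                    (1 - q ^+ (7 * i + 7)))).
  by apply: lreg_prod => i _; apply: lregM; [apply: lregM|]; apply: (lreg_1subX qN0); lia.
apply: reg; rewrite mulr1 [RHS]g; ring.
Qed.
End TilingSums.

(** * Enumeration of partitions and bipartitions *)

(** This reduces each of the three cardinals to counting the entries of weight [n] in an explicit
    list, whose generating function can be computed. *)
Lemma card_sub_count (X : eqType) (P : pred X) (sT : subFinType P) (Q : pred X)
    (w : X -> nat) n (s : seq X) :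
  uniq s -> (forall x, (x \in s) && (w x == n) = P x && Q x) ->
  #|[set x : sT | Q (val x)]| = count (fun x => w x == n) s.
Proof.
move=> us sP; rewrite cardE -(size_map val) -size_filter; apply: perm_size.
apply: uniq_perm; rewrite ?filter_uniq ?(map_inj_uniq val_inj) ?enum_uniq // => x.
rewrite mem_filter andbC sP; apply/mapP/andP => [[y]|[Px Qx]].
  by rewrite mem_enum inE => Qy ->; split=> //; apply: valP.
by exists (Sub x Px); rewrite ?mem_enum ?inE SubK.
Qed.

Lemma sorted_split_max m p : sorted geq p -> all (leq^~ m.+1) p ->
  p = nseq (count_mem m.+1 p) m.+1 ++ [seq x <- p | (x <= m)%N].
Proof.
elim: p => //= x p IH; rewrite path_sortedE; last exact: rev_trans leq_trans.
move=> /andP[xp sp] /andP[xm pm].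
have [xE|xm1] := eqVneq x m.+1; first by rewrite xE ltnn /= -IH.
have {}xm : (x <= m)%N by rewrite -ltnS ltn_neqAle xm1.
rewrite xm (count_memPn _) /=.
  by congr (_ :: _); apply/esym/all_filterP; apply: sub_all xp => y /leq_trans; apply.
by apply/negP => /(allP xp) /=; rewrite leqNgt ltnS xm.
Qed.

Section Enumerations.
Variables (R : comNzRingType) (q : R) (N : nat).
Hypothesis qN0 : q ^+ N = 0.

Lemma sum_count (X : Type) (w : X -> nat) (s : seq X) :
  \sum_(n < N) q ^+ n *+ count (fun x => w x == n) s = \sum_(x <- s) q ^+ w x.
Proof.
elim: s => [|x s IH]; first by rewrite big_nil big1.
rewrite big_cons -IH; under eq_bigr do rewrite /= mulrnDr.
rewrite big_split; congr (_ + _).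
have [wN|Nw] := ltnP (w x) N.
  rewrite (bigD1 (Ordinal wN)) //= eqxx mulr1n big1 ?addr0 // => i iw.
  by rewrite (negPf (_ : w x != i)) //; apply: contra iw => /eqP wi; apply/eqP/val_inj.
rewrite (expr_nil qN0) // big1 // => i _.
by rewrite (negPf (_ : w x != i)) //; have := ltn_ord i; lia.
Qed.

(** Multiplicities stay below [N] to match the [N]-term geometric series that inverts
    [1 - q ^+ m]. *)
Fixpoint restricted_partitions (D : pred nat) (m : nat) : seq (seq nat) :=
  if m is m'.+1 then
    if D m then [seq nseq k m ++ p | k <- iota 0 N, p <- restricted_partitions D m']
    else restricted_partitions D m'
  else [:: [::]].

Lemma restricted_partitions_sum D m :
  (\sum_(p <- restricted_partitions D m) q ^+ sumn p) *
  (\prod_(i < m | D i.+1) (1 - q ^+ i.+1)) = 1.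
Proof.
elim: m => [|m IH] /=; first by rewrite big_seq1 big_ord0 mulr1.
rewrite (big_mkcond (fun i : 'I_m.+1 => D i.+1)) big_ord_recr -big_mkcond /=.
case: ifP => Dm; last by rewrite mulr1.
rewrite big_allpairs_dep /=.
have -> : \sum_(k <- iota 0 N) \sum_(p <- restricted_partitions D m)
      q ^+ sumn (nseq k m.+1 ++ p) =
    (\sum_(k < N) q ^+ (m.+1 * k)) * \sum_(p <- restricted_partitions D m) q ^+ sumn p.
  rewrite mulr_suml -(big_mkord predT (fun k => q ^+ (m.+1 * k) * _)) /index_iota subn0.
  apply: eq_bigr => k _; rewrite mulr_sumr; apply: eq_bigr => p _.
  by rewrite sumn_cat sumn_nseq exprD.
by rewrite [X in _ * X = _]mulrC mulrACA IH mulr1 mulrC (mul_geom qN0).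
Qed.

(** A sum below [N] keeps every multiplicity below [N], so the cap excludes nothing. *)
Lemma restricted_partitions_mem (D : pred nat) m p : (forall x, D x -> (0 < x)%N) ->
  (sumn p < N)%N ->
  (p \in restricted_partitions D m) = [&& sorted geq p, all D p & all (leq^~ m) p].
Proof.
move=> D0; elim: m p => [|m IH] p pN /=.
  rewrite inE; case: p pN => //= x p _; apply/esym/negP => /and3P[_ /andP[/D0 x0 _]].
  by rewrite leqn0 => /andP[/eqP x1]; rewrite x1 in x0.
have notD : ~~ D m.+1 -> [&& sorted geq p, all D p & all (leq^~ m) p] =
    [&& sorted geq p, all D p & all (leq^~ m.+1) p].
  move=> Dm; congr (_ && _); rewrite -!all_predI; apply: eq_in_all => x _ /=.
  by rewrite [in RHS]leq_eqVlt ltnS; case: eqVneq => [->|//]; rewrite (negPf Dm).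
case: ifP => [Dm|/negbT/notD <-]; last exact: IH.
apply/allpairsPdep/and3P => [[k [u [_ um pE]]]|[sp Dp lep]].
  have uN : (sumn u < N)%N by move: pN; rewrite pE sumn_cat; lia.
  move: um; rewrite IH // pE => /and3P[su Du leu]; split.
  - elim: k {pE} => //= k IHk; rewrite path_sortedE; last exact: rev_trans leq_trans.
    rewrite IHk andbT all_cat all_nseq /= leqnn orbT /=.
    by apply: sub_all leu => x; apply: leqW.
  - by rewrite all_cat Du andbT all_nseq Dm orbT.
  by rewrite all_cat all_nseq leqnn orbT /=; apply: sub_all leu => x; apply: leqW.
have pE := sorted_split_max sp lep.
exists (count_mem m.+1 p), [seq x <- p | (x <= m)%N]; split=> //.
  rewrite mem_iota add0n /=; apply: leq_ltn_trans pN.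
  by rewrite {2}pE sumn_cat sumn_nseq mulSn -addnA leq_addr.
rewrite IH ?filter_all ?all_filter ?andbT.
- rewrite sorted_filter //=; last exact: rev_trans leq_trans.
  by apply: sub_all Dp => x Dx; apply/implyP.
- by apply: leq_ltn_trans pN; rewrite {2}pE sumn_cat leq_addl.
Qed.

Lemma restricted_partitions_uniq D m : uniq (restricted_partitions D m).
Proof.
have le_m k p : p \in restricted_partitions D k -> all (leq^~ k) p.
  elim: k p => [|k IH] p /=; first by rewrite inE => /eqP ->.
  have le_k u : u \in restricted_partitions D k -> all (leq^~ k.+1) u.
    by move=> /IH; apply: sub_all => x; apply: leqW.
  case: ifP => _; last exact: le_k.
  move=> /allpairsPdep[j [u [_ /le_k uk ->]]].
  by rewrite all_cat uk all_nseq leqnn orbT.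
elim: m => [|m IH] //=; case: ifP => // _.
apply: allpairs_uniq => [||[k u] [j v]]; rewrite ?iota_uniq //.
have no_m w : w \in restricted_partitions D m -> count_mem m.+1 w = 0%N.
  move=> /le_m /allP wm; apply/count_memPn; apply/negP => /wm.
  by rewrite ltnn.
move=> /allpairsP[[k' u'] /= [_ um [-> ->]]] /allpairsP[[j' v'] /= [_ vm [-> ->]]] /= e.
have kj : k' = j'.
  have /(congr1 (count_mem m.+1)) := e.
  by rewrite !count_cat !count_nseq /= eqxx !mul1n !no_m // !addn0.
by move: e; rewrite kj => /eqP; rewrite eqseq_cat // eqxx /= => /eqP ->.
Qed.
End Enumerations.

Definition pm12_mod7 (i : nat) : bool :=
  [|| i == 1 %[mod 7], i == 2 %[mod 7], i == 5 %[mod 7] | i == 6 %[mod 7]].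

Lemma leq_sumn (x : nat) p : x \in p -> (x <= sumn p)%N.
Proof.
elim: p => //= y p IH; rewrite inE => /orP[/eqP->|/IH]; first exact: leq_addr.
by move=> /leq_trans; apply; apply: leq_addl.
Qed.

Lemma A_count N m n : (n < N <= m)%N ->
  A n = count (fun p => sumn p == n) (restricted_partitions N pm12_mod7 m).
Proof.
move=> /andP[nN Nm].
apply: (@card_sub_count _ _ (partition_of n) parts_pm12_mod7).
  exact: restricted_partitions_uniq.
move=> p; rewrite /is_partition_of /is_partition.
have [pn|] := eqVneq (sumn p) n; last by rewrite !andbF.
rewrite restricted_partitions_mem ?pn // => [|x]; last by case: x.
rewrite !andbT -andbA; congr (_ && _).
rewrite (_ : all _ p && _ = all pm12_mod7 p); last first.
  by apply: andb_idr => _; apply/allP => x /leq_sumn; lia.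
rewrite -[parts_pm12_mod7 p]/(all pm12_mod7 p) andbC; apply/esym/andb_idr.
by move=> /allP pD; apply/negP => /pD.
Qed.

(** * Bipartitions under the exclusion conditions as tilings with a free choice of lambda *)

Definition exclusion_cond (c : nat) (p l : seq nat) : bool :=
  [&& distinct_even_gap4 p, uniq l &
      all (fun j => let e := asc_part p j in
             [&& e %/ 2 + c * j.-1 \notin l, e %/ 2 + c * j.-1 + 1 \notin l
               & e %/ 2 + c * j.-1 + 2 \notin l]%N)
          (iota 1 (size p))].

Lemma B_condE p l : B_cond p l = exclusion_cond 0 p l.
Proof.
congr [&& _, _ & _]; apply: eq_in_all => j _.
by rewrite /= mul0n addn0.
Qed.

Lemma C_condE p l : C_cond p l = exclusion_cond 1 p l.
Proof.
congr [&& _, _ & _]; apply: eq_in_all => j; rewrite mem_iota => /andP[j0 _] /=.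
by congr [&& _ \notin l, _ \notin l & _ \notin l]; lia.
Qed.

(** The conditions, indexed by the parts of pi, are regrouped by the parts of lambda; passing to the
    next tile moves one [c] from [c * j.-1] into [s]. *)
Lemma exclusion_covered c s hs (l : seq nat) :
  all (fun j => [&& nth 0 hs j.-1 + s + c * j.-1 \notin l,
                    nth 0 hs j.-1 + s + c * j.-1 + 1 \notin l
                  & nth 0 hs j.-1 + s + c * j.-1 + 2 \notin l]%N)
      (iota 1 (size hs)) =
  all (fun i => ~~ covered c s hs i) l.
Proof.
elim: hs s => [|h hs IH] s; first by rewrite /= all_predT.
rewrite -[iota 1 _]/(1%N :: iota (1 + 1) (size hs)) iotaDl /= all_map muln0 addn0.
under [RHS]eq_all do rewrite negb_or.
rewrite (all_predI (fun i => ~~ (h + s <= i <= h + s + 2)%N)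
  (fun i => ~~ covered c (s + c) hs i)).
rewrite -IH; congr (_ && _).
  apply/and3P/allP => [[l0 l1 l2] i il|hl].
    apply/negP => hi; have [E|[E|E]] : (i = h + s \/ i = h + s + 1 \/ i = h + s + 2)%N by lia.
    - by rewrite -E il in l0.
    - by rewrite -E il in l1.
    by rewrite -E il in l2.
  by split; apply/negP => /hl; lia.
apply: eq_in_all => j; rewrite mem_iota => /andP[j0 _] /=.
have -> : (nth 0 (h :: hs) j + s + c * j = nth 0 hs j.-1 + (s + c) + c * j.-1)%N; last by [].
by case: j j0 => //= j _; rewrite mulnS; lia.
Qed.

Definition doubled (hs : seq nat) : seq nat := rev (map (muln 2) hs).

(** Positions for lambda are listed downwards so that subsequences are already non-increasing. *)
Definition configurations (N c : nat) : seq (seq nat * seq nat) :=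
  [seq (doubled hs, l) | hs <- tilings N 1,
     l <- subseqs [seq i <- rev (index_iota 1 N) | ~~ covered c 0 hs i]].

Lemma subseqs_sum (R : comNzRingType) (q : R) (s : seq nat) :
  \sum_(l <- subseqs s) q ^+ sumn l = \prod_(i <- s) (1 + q ^+ i).
Proof.
elim: s => [|x s IH] /=; first by rewrite big_seq1 big_nil.
rewrite big_cat big_map big_cons -IH mulrDl mul1r mulr_sumr; congr (_ + _).
by apply: eq_bigr => l _; rewrite exprD.
Qed.

Lemma configurations_sum (R : comNzRingType) (q : R) N c :
  \sum_(b <- configurations N c) q ^+ (sumn b.1 + sumn b.2) =
  tiling_sum q N c predT 0 1 1.
Proof.
rewrite big_allpairs_dep; apply: eq_bigr => hs _ /=.
under eq_bigr do rewrite exprD.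
rewrite -mulr_sumr subseqs_sum; congr (_ * _).
  congr (_ ^+ _); rewrite /doubled sumn_rev.
  by elim: hs => //= h hs ->; rewrite mulnDr.
rewrite /free_prod big_filter; apply: perm_big.
by rewrite perm_rev.
Qed.

Lemma doubled_inj : injective doubled.
Proof.
move=> hs hs' /(congr1 (map half \o rev)) /=; rewrite /doubled !revK -!map_comp.
by rewrite !map_id_in // => x _ /=; rewrite mul2n doubleK.
Qed.

Lemma configurations_uniq N c : uniq (configurations N c).
Proof.
apply: allpairs_uniq_dep.
- by rewrite filter_uniq ?subseqs_uniq ?iota_uniq.
- by move=> hs _; rewrite subseqs_uniq // filter_uniq // rev_uniq iota_uniq.
by move=> [hs l] [hs' l'] _ _ [/= /doubled_inj -> ->].
Qed.

Lemma sorted_subseq (T : eqType) (r : rel T) (s t : seq T) :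
  transitive r -> irreflexive r -> sorted r s -> sorted r t ->
  {subset s <= t} -> subseq s t.
Proof.
move=> rtr rirr ss st sub.
have -> : s = [seq x <- t | x \in s]; last exact: filter_subseq.
apply: (irr_sorted_eq rtr rirr ss); first exact: sorted_filter.
by move=> x; rewrite mem_filter; apply/esym/andb_idr/sub.
Qed.

Lemma gtn_trans : transitive gtn.
Proof. by move=> y x z /[swap]; apply: ltn_trans. Qed.

Lemma gap2_sorted_ltn hs : sorted gap2 hs -> sorted ltn hs.
Proof. by apply: sub_sorted => x y; rewrite /gap2; lia. Qed.

Lemma exclusion_doubled c hs l :
  exclusion_cond c (doubled hs) l =
  [&& sorted gap2 hs, uniq l & all (fun i => ~~ covered c 0 hs i) l].
Proof.
have sE : sorted (fun x y => (y + 4 <= x)%N) (doubled hs) = sorted gap2 hs.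
  rewrite rev_sorted sorted_map; apply: eq_sorted => x y /=.
  by rewrite /gap2; lia.
rewrite /exclusion_cond /distinct_even_gap4 sE; congr [&& _, _ & _].
  have -> /= : all (fun e => ~~ odd e) (doubled hs).
    by rewrite all_rev all_map; apply/allP => x _; rewrite /= mul2n odd_double.
  apply: andb_idl => /gap2_sorted_ltn /(sorted_uniq ltn_trans ltnn) uhs.
  by rewrite rev_uniq map_inj_uniq // => x y /eqP; rewrite eqn_mul2l => /eqP.
rewrite -exclusion_covered size_rev size_map; apply: eq_in_all => j.
rewrite mem_iota => /andP[j0 jn].
have -> : (asc_part (doubled hs) j %/ 2 = nth 0 hs j.-1)%N.
  by rewrite /asc_part revK (nth_map 0%N) ?mulKn //; lia.
by rewrite /= !addn0.
Qed.

Lemma is_bipartition_ofE n p l :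
  is_bipartition_of n (p, l) =
  [&& is_partition p, is_partition l & sumn p + sumn l == n]%N.
Proof.
rewrite /is_bipartition_of /= /is_partition_of sumn_part_union.
case pP: (is_partition p) => //; case lP: (is_partition l) => //=.
have -> // : is_partition (part_union p l).
rewrite /is_partition sort_sorted /=; last by move=> x y; apply: leq_total.
by rewrite mem_sort mem_cat negb_or; case/andP: pP => _ ->; case/andP: lP.
Qed.

(** The bound on the total keeps all halves and parts below [N], within the enumerated ranges.
    Conversely, halving the reversed [p] recovers the tiles, as its parts are even. *)
Lemma mem_configurations N c p l : (sumn p + sumn l < N)%N ->
  ((p, l) \in configurations N c) =
  [&& is_partition p, is_partition l & exclusion_cond c p l].
Proof.
move=> plN; apply/allpairsPdep/and3P => [[hs [l' [hsT lS [pE lE]]]]|[pP lP cond]].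
  subst p l'; move: hsT lS; rewrite mem_filter !mem_subseqs => /andP[ghs hsub] lsub.
  have ls : sorted gtn l.
    apply: (subseq_sorted gtn_trans lsub); apply: (sorted_filter gtn_trans).
    by rewrite rev_sorted iota_ltn_sorted.
  have lmem x : x \in l -> ~~ covered c 0 hs x /\ (0 < x)%N.
    move/(mem_subseq lsub); rewrite mem_filter mem_rev mem_index_iota.
    by case/and3P.
  have hs0 x : x \in hs -> (0 < x)%N by move/(mem_subseq hsub); rewrite mem_iota => /andP[].
  split.
  - apply/andP; split; last first.
      by rewrite mem_rev; apply/mapP => -[x /hs0 x0 /eqP]; rewrite eq_sym muln_eq0 /=; lia.
    rewrite rev_sorted sorted_map; apply: sub_sorted ghs => x y.
    by rewrite /gap2 /=; lia.
  - apply/andP; split; last by apply/negP => /lmem[].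
    by apply: sub_sorted ls => x y /=; apply: ltnW.
  rewrite exclusion_doubled ghs (sorted_uniq gtn_trans) //=; last exact: ltnn.
  by apply/allP => x /lmem[].
pose hs := map half (rev p).
have pE : p = doubled hs.
  case/and3P: cond => /and3P[_ pe _] _ _; rewrite /doubled /hs -map_comp map_rev revK.
  rewrite map_id_in // => x xp /=; rewrite mul2n.
  by rewrite -[RHS]odd_double_half (negPf (allP pe x xp)).
move: cond; rewrite pE exclusion_doubled => /and3P[ghs ul lcov].
have hsp x : x \in hs -> (0 < x < N)%N.
  move=> xhs; have xp : (2 * x)%N \in p by rewrite pE mem_rev; apply: map_f.
  have := leq_sumn xp; case/andP: pP => _ p0 xs.
  have x0 : x != 0%N by apply: contra p0 => /eqP xz; rewrite xz in xp.
  by lia.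
exists hs, l; split=> //; rewrite ?mem_filter mem_subseqs ?ghs.
  apply: (sorted_subseq ltn_trans ltnn (gap2_sorted_ltn ghs) (iota_ltn_sorted _ _)).
  by move=> x /hsp; rewrite mem_iota; lia.
apply: (sorted_subseq gtn_trans ltnn).
- by rewrite gtn_sorted_uniq_geq ul; case/andP: lP.
- by apply: (sorted_filter gtn_trans); rewrite rev_sorted iota_ltn_sorted.
move=> x xl; rewrite mem_filter (allP lcov) //= mem_rev mem_index_iota.
have := leq_sumn xl; case/andP: lP => _ l0.
have : x != 0%N by apply: contra l0 => /eqP <-.
by lia.
Qed.

Lemma exclusion_count N c n : (n < N)%N ->
  #|[set b : bipartition_of n | exclusion_cond c b.1 b.2]| =
  count (fun b => sumn b.1 + sumn b.2 == n)%N (configurations N c).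
Proof.
move=> nN.
apply: (@card_sub_count _ _ (bipartition_of n) (fun b => exclusion_cond c b.1 b.2)
  (fun b => sumn b.1 + sumn b.2)%N); first exact: configurations_uniq.
move=> [p l] /=; rewrite is_bipartition_ofE.
have [pln|] := eqVneq (sumn p + sumn l)%N n; last by rewrite !andbF.
by rewrite mem_configurations ?pln // !andbT -andbA.
Qed.

Lemma B_count N n : (n < N)%N ->
  B n = count (fun b => sumn b.1 + sumn b.2 == n)%N (configurations N 0).
Proof.
move=> nN; rewrite -(exclusion_count 0 nN); apply: eq_card => b.
by rewrite !inE B_condE.
Qed.

Lemma C_count N n : (n < N)%N ->
  C n = count (fun b => sumn b.1 + sumn b.2 == n)%N (configurations N 1).
Proof.
move=> nN; rewrite -(exclusion_count 1 nN); apply: eq_card => b.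
by rewrite !inE C_condE.
Qed.

(** * Equality of the generating functions and passage to coefficients *)

Section GeneratingFunctions.
Variables (R : comNzRingType) (q : R) (N : nat).
Hypothesis qN0 : q ^+ N = 0.

Lemma sum_A_B : \sum_(n < N) q ^+ n *+ A n = \sum_(n < N) q ^+ n *+ B n.
Proof.
under [RHS]eq_bigr => n _ do rewrite (B_count (ltn_ord n)).
under [LHS]eq_bigr => n _.
  rewrite (@A_count N (7 * N.*2)); [over|by have := ltn_ord n; lia].
rewrite !(sum_count qN0) configurations_sum.
have := restricted_partitions_sum qN0 pm12_mod7 (7 * N.*2).
have -> : \prod_(i < 7 * N.*2 | pm12_mod7 i.+1) (1 - q ^+ i.+1) =
    \prod_(i < N.*2) ((1 - q ^+ (7 * i + 1)) * (1 - q ^+ (7 * i + 2)) *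
    (1 - q ^+ (7 * i + 5)) * (1 - q ^+ (7 * i + 6))).
  elim: N.*2 => [|n IH]; first by rewrite muln0 !big_ord0.
  rewrite big_mkcond mulnS addnC !addnS addn0 !big_ord_recr -big_mkcond /= IH -!mulrA.
  have shift k : pm12_mod7 (7 * n + k) = pm12_mod7 k.
    by rewrite /pm12_mod7 mulnC !modnMDl.
  have mod7 k : pm12_mod7 (iter k succn (7 * n)) = pm12_mod7 k.
    by rewrite iter_succn shift.
  rewrite (mod7 1%N) (mod7 2%N) (mod7 3%N) (mod7 4%N) (mod7 5%N) (mod7 6%N) (mod7 7%N) /=.
  by rewrite !addnS !addn0 !mul1r !mulr1.
move=> Aprod; have Bprod := tiling_sum_product qN0.
set S := \sum_(p <- _) _ in Aprod *; set P := \prod_(i < _) _ in Aprod Bprod.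
(* Both series are inverses of the same product [P], hence equal. *)
by rewrite -[S]mulr1 -Bprod mulrCA Aprod mulr1.
Qed.

Lemma sum_B_C : \sum_(n < N) q ^+ n *+ B n = \sum_(n < N) q ^+ n *+ C n.
Proof.
under eq_bigr => n _ do rewrite (B_count (ltn_ord n)).
under [RHS]eq_bigr => n _ do rewrite (C_count (ltn_ord n)).
by rewrite !(sum_count qN0) !configurations_sum (tiling_sum_B_C qN0).
Qed.
End GeneratingFunctions.

(** The identity is specialised to the class of X in Z[X]/(X^N), where the coefficient of X^n is
    well defined for [n < N] and integers separate naturals. *)
Lemma coef_eq_nilpotent (a b : nat -> nat) n :
  (forall (R : comNzRingType) (q : R) N, q ^+ N = 0 ->
     \sum_(k < N) q ^+ k *+ a k = \sum_(k < N) q ^+ k *+ b k) ->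
  a n = b n.
Proof.
(* The exponent exceeds [n], and is at least 2 so that X is its own reduced representative even for
   [n = 0]. *)
move=> ab; pose N := n.+2; pose h : {poly int} := 'X^N.
pose x : {poly %/ h} := 'qX.
have hE : mk_monic h = h by rewrite mk_monic_Xn.
have valX : x = 'X :> {poly int}.
  by rewrite qpolyXE ?size_polyXn ?monicXn.
have valM (u v : {poly %/ h}) : u * v = rmodp ((u : {poly int}) * v) h :> {poly int}.
  exact: (congr1 (rmodp ((u : {poly int}) * v)) hE).
have xk k : (k < N)%N -> x ^+ k = 'X^k :> {poly int}.
  elim: k => [|k IH] kN; first by rewrite !expr0.
  rewrite exprS valM valX IH ?(ltnW kN) // -exprS rmodp_small //.
  by rewrite !size_polyXn ltnS.
have xN : x ^+ N = 0.
  apply: val_inj; rewrite (exprS x n.+1) [LHS]valM valX xk // -exprS.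
  by rewrite rmodpp ?monicXn.
have := congr1 (fun u : {poly %/ h} => (u : {poly int})`_n) (ab _ x N xN).
have coefE (c : nat -> nat) : (\sum_(k < N) x ^+ k *+ c k : {poly %/ h})`_n = (c n)%:R :> int.
  rewrite coefn_sum.
  have xkn (k : 'I_N) : (x ^+ k *+ c k)`_n = (if k == n :> nat then (c n)%:R else 0) :> int.
    have -> : (x ^+ k *+ c k) = 'X^k *+ c k :> {poly int}.
      by elim: (c k) => // m IH; rewrite !mulrS -IH -xk.
    rewrite coefMn coefXn eq_sym; case: eqP => [->|_]; last by rewrite mul0rn.
    by rewrite mulr1n.
  under eq_bigr do rewrite xkn.
  have nN : (n < N)%N by rewrite /N.
  by rewrite -big_mkcond (big_pred1 (Ordinal nN)).
by rewrite !coefE => /eqP; rewrite Num.Theory.eqr_nat => /eqP.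
Qed.

Unset Implicit Arguments.
Local Close Scope ring_scope.

Theorem theorem7 (n : nat) (hn : 0 < n) : A n = B n /\ B n = C n.
Proof.
split; apply: coef_eq_nilpotent => R q N qN0; [exact: sum_A_B | exact: sum_B_C].
Qed.
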